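(* Let $T$ be a closable (linear, densely defined) operator from a Hilbert space $H$ to a Hilbert space $K$, with domain $\mathcal D(T)\subset H$, and let $S=\{x\in\mathcal D(T): \|Tx\|\le 1\}$. (a) The restriction $T|_S$ is continuous in the weak topologies (that is, as a map from $S$ with the topology inherited from the weak topology of $H$ to $K$ with its weak topology), and $S$ is closed in $\mathcal D(T)$. (b) If $T$ is closed, then $S$ is a closed set (in $H$).
   Context: An operator $T$ is closed if its graph is closed in $H\times K$, and closable if the closure of its graph is the graph of an operator. ''Closed in $\mathcal D(T)$'' refers to the topology $\mathcal D(T)$ inherits from $H$. *)

(* Defs.v *)
From HB Require Import structures.
From mathcomp Require Import all_boot all_order all_algebra.
From mathcomp Require Import complex.
From mathcomp Require Import all_classical all_reals all_analysis.
Import Order.TTheory GRing.Theory Num.Theory.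
Import numFieldTopology.Exports numFieldNormedType.Exports.

Set Implicit Arguments.
Unset Strict Implicit.
Unset Printing Implicit Defensive.

Local Open Scope classical_set_scope.
Local Open Scope ring_scope.

(* The scalar field of a Hilbert space is the real or the complex field; it
   comes with its conjugation, which is the identity over the reals. *)
Inductive real_or_complex : forall F : numFieldType, (F -> F) -> Prop :=
| RealScalars (R : realType) : @real_or_complex R idfun
| ComplexScalars (R : realType) : @real_or_complex R[i] (@Num.conj R[i]).

(* [{dot H for conj}] is linear in its first argument, conjugate-linear in the
   second one, hermitian and positive definite. *)
HB.mixin Record NormedModule_isInner (F : numFieldType) (conj : F -> F) H
    & NormedModule F H := {
  inner : {dot H for conj};
  sqr_norm_inner : forall x : H, `|x| ^+ 2 = inner x x
}.

#[short(type="hilbertType")]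
HB.structure Definition Hilbert (F : numFieldType) (conj : F -> F) :=
  {H of CompleteNormedModule F H & NormedModule_isInner F conj H}.

Record dual (F : numFieldType) (V : normedModType F) := Dual {
  dual_fun :> {linear V -> F^o};
  dual_continuous : continuous dual_fun
}.

(* The coarsest topology making every element of the dual continuous. *)
Definition weak_topology (F : numFieldType) (V : normedModType F) : Type := V.

HB.instance Definition _ (F : numFieldType) (V : normedModType F) :=
  Topological.copy (weak_topology V)
    (sup_topology (fun f : dual V => Topological.on (initial_topology f))).

(* A linear operator whose domain is a linear subspace; the values of [app]
   outside of [dom] are irrelevant. *)
Record operator (F : numFieldType) (V W : lmodType F) := Operator {
  dom : set V;
  app :> V -> W;
  dom0 : dom 0;
  dom_linear : forall a x y, dom x -> dom y -> dom (a *: x + y);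
  app_linear : forall a x y, dom x -> dom y ->
    app (a *: x + y) = a *: app x + app y
}.

Definition graph (F : numFieldType) (V W : lmodType F) (T : operator V W) :
    set (V * W) :=
  [set p | dom T p.1 /\ p.2 = T p.1].

Definition closed_operator (F : numFieldType) (V W : normedModType F)
    (T : operator V W) : Prop :=
  closed (graph T).

Definition closable (F : numFieldType) (V W : normedModType F)
    (T : operator V W) : Prop :=
  exists T' : operator V W, closure (graph T) = graph T'.

(* Main.v *)
Require Import Defs.
From HB Require Import structures.
From mathcomp Require Import all_boot all_order all_algebra.
From mathcomp Require Import complex ring.
From mathcomp Require Import all_classical all_reals all_analysis.
Import Order.TTheory GRing.Theory Num.Theory.
Import numFieldTopology.Exports numFieldNormedType.Exports.

Set Implicit Arguments.
Unset Strict Implicit.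
Unset Printing Implicit Defensive.

Local Open Scope classical_set_scope.
Local Open Scope ring_scope.

(** Everything is deduced from one fact about a Hilbert space, the lemma
[convex_filter_cluster]: a filter with a base of midpoint-convex sets, all of
which meet a fixed ball, has a cluster point.  By the parallelogram law the
points of almost least norm in the small sets of the filter form a Cauchy filter.

Applied in [K] to the images under a closed operator [T] of the traces of the
neighbourhoods of [x] on a set [C], this fact yields a [v] such that [(x, v)]
lies in the closure of the graph, so that [v = T x].  Hence, when [D] is
closed, convex and bounded, the set of all [x] in the domain with [T x] in [D]
is closed ([closed_preimage_bounded_convex]).  With the unit ball for [D] this
is (b).  A closable [T] is the restriction of a closed [T'], so [S] is the trace
on the domain of [T] of the closed set that belongs to [T']; this is the second
half of (a).

Applied in [H] to the constant filter of a closed convex set, the same fact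
yields a point [p] of least norm; if [p] is not [0], then [x |-> '[x, p]] is
bounded away from [0] on the set ([closed_convex_separation]).

For the weak continuity, let [g] be in the dual of [K] and [e > 0].  The set of
all [z] in the domain of [T'] with [`|T' z| <= 1] and [e <= g (T' z)] is convex,
it is closed by the first application, and it does not contain [0].  So some
[f] in the dual of [H] is at least [c > 0] in modulus on it: when [T' z] is in
the unit ball, [`|f z| < c] forces [`|g (T' z)| < e]
([dual_small_on_ball]).  Taking [z = (x - y) / 2] with [x] and [y] in [S]
turns this continuity at [0] into continuity on [S].

The field [F] is only partially ordered when it is the complex field, and
[a <= b] then says that [b - a] is a nonnegative real.  Sets such as
[e <= g v] are still closed and convex for this order, which replaces real parts
throughout. *)

(** * Real and complex scalars *)

Section Scalars.
Variables (F : numFieldType) (conj : F -> F).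
Hypothesis scalars : real_or_complex conj.

Lemma mulr_conj a : a * conj a = `|a| ^+ 2.
Proof.
case: scalars a => R a /=; last by rewrite normCK.
by rewrite real_normK ?num_real.
Qed.

Lemma conj0 : conj 0 = 0.
Proof. by case: scalars => R //=; rewrite rmorph0. Qed.

Lemma norm_conj a : `|conj a| = `|a|.
Proof. by case: scalars a => R a //=; rewrite norm_conjC. Qed.

Lemma conjM_ge0 t a : 0 <= t -> conj (t * a) = t * conj a.
Proof.
case: scalars t a => R t a //= t0.
by rewrite rmorphM /= geC0_conj.
Qed.

(** In the complex case nonnegative scalars are real, so that the supremum can
be taken on real parts. *)
Lemma exists_sup (L : set F) (M : F) : L !=set0 ->
  (forall l, L l -> 0 <= l <= M) ->
  exists s, (forall l, L l -> l <= s) /\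
    (forall e, 0 < e -> exists2 l, L l & s - e < l).
Proof.
case: scalars L M => R L M [l0 Ll0] LM.
  have supL : has_sup L by split; [exists l0|exists M => l /LM /andP[]].
  exists (sup L); split=> [l Ll|e e0]; first exact: ub_le_sup supL.2 _ Ll.
  exact: sup_adherent.
have LRe l : L l -> l = (complex.Re l)%:C%C.
  by move=> /LM /andP[l_ge0 _]; rewrite RRe_real ?ger0_real.
have supL : has_sup ((@complex.Re R) @` L).
  split; first by exists (complex.Re l0), l0.
  exists (complex.Re M) => _ [l /LM /andP[_ lM] <-].
  by move: lM; rewrite lecE => /andP[].
exists (sup ((@complex.Re R) @` L))%:C%C; split=> [l Ll|e e0].
  by rewrite (LRe l Ll) lecR; apply: ub_le_sup supL.2 _ _; exists l.
have eE : e = (complex.Re e)%:C%C by rewrite RRe_real ?gtr0_real.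
have Re0 : 0 < complex.Re e by move: e0; rewrite eE ltcR.
have [_ [l Ll <-] sl] := sup_adherent Re0 supL.
by exists l => //; rewrite eE (LRe l Ll) -rmorphB ltcR.
Qed.

End Scalars.

(** The nonnegative cone is the set of fixed points of the norm. *)
Lemma closed_nonneg (F : numFieldType) : closed [set x : F | 0 <= x].
Proof.
move=> x clx /=; suff -> : x = `|x| by exact: normr_ge0.
apply/eqP; rewrite -subr_eq0 -normr_le0; apply/ler_addgt0Pl => e e0.
have e20 : 0 < e / 2 by rewrite divr_gt0.
have [y [/= y0 xy]] := clx _ (nbhsx_ballx x _ e20).
move: xy; rewrite -ball_normE /= => xy; rewrite addr0.
have -> : x - `|x| = (x - y) - (`|x| - `|y|).
  by rewrite (ger0_norm y0) opprB addrA subrK.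
rewrite (splitr e) (le_trans (ler_normB _ _))// lerD// ?ltW//.
exact: le_lt_trans (ler_dist_dist _ _) xy.
Qed.

Lemma closed_ger (F : numFieldType) (T : topologicalType) (f : T -> F) (a : F) :
  continuous f -> closed [set x | a <= f x].
Proof.
move=> cf.
have -> : [set x | a <= f x] = (fun x => f x - a) @^-1` [set x | 0 <= x].
  by apply/seteqP; split=> x /=; rewrite subr_ge0.
apply: preimage_closed; last exact: closed_nonneg.
by move=> x _; apply: cvgB; [exact: cf|exact: cvg_cst].
Qed.

(** * Convex sets *)

Lemma convex_setP (R : numDomainType) (V : lmodType R) (A : set V) :
  convex_set A <-> forall t x y, 0 <= t <= 1 -> A x -> A y ->
    A (t *: x + (1 - t) *: y).
Proof.
split=> [cA t x y /andP[t0 t1] Ax Ay|cA x y t /set_mem Ax /set_mem Ay].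
  by have /set_mem := cA x y (Itv01 t0 t1) (mem_set Ax) (mem_set Ay).
by apply/mem_set/cA => //; rewrite ge0 le1.
Qed.

Section NormBall.
Variables (F : numFieldType) (V : normedModType F).

Lemma closed_norm_le (r : F) : closed [set v : V | `|v| <= r].
Proof.
have -> : [set v : V | `|v| <= r] = [set v | - r <= - `|v|].
  by apply/seteqP; split=> v /=; rewrite lerN2.
by apply: closed_ger => v; apply: cvgN; exact: norm_continuous.
Qed.

Lemma convex_norm_le (r : F) : convex_set [set v : V | `|v| <= r].
Proof.
apply/convex_setP => t v w /andP[t0 t1] /= vr wr.
have t'0 : 0 <= 1 - t by rewrite subr_ge0.
have -> : r = t * r + (1 - t) * r by ring.
by rewrite (le_trans (ler_normD _ _))// !normrZ !ger0_norm// lerD// ler_wpM2l.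
Qed.

End NormBall.

(** * Hilbert spaces *)

Section HilbertSpace.
Variables (F : numFieldType) (conj : F -> F).
Hypothesis scalars : real_or_complex conj.
Variable H : hilbertType conj.
Implicit Types x y z p : H.

Local Notation "''[' x , y ]" := (@inner F conj H x y) : ring_scope.

Lemma innerC x y : '[x, y] = conj '[y, x].
Proof.
rewrite [LHS](@hermitian_subproof _ _ _ _ (@inner F conj H)).
by rewrite expr0 mul1r.
Qed.

Lemma innerDl x y p : '[x + y, p] = '[x, p] + '[y, p].
Proof. exact: linearDl. Qed.

Lemma innerBl x y p : '[x - y, p] = '[x, p] - '[y, p].
Proof. exact: linearBl. Qed.

Lemma innerZl a x p : '[a *: x, p] = a * '[x, p].
Proof. exact: (linearZl_LR (@inner F conj H)). Qed.

Lemma innerBr p x y : '[p, x - y] = '[p, x] - '[p, y].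
Proof. exact: linearBr. Qed.

(** The inner product is only conjugate-linear in its second argument, but
conjugation fixes the nonnegative scalars. *)
Lemma innerZr_ge0 t x y : 0 <= t -> '[x, t *: y] = t * '[x, y].
Proof.
move=> t0; rewrite innerC innerZl conjM_ge0//.
by rewrite -innerC.
Qed.

Lemma sqr_normD x y :
  `|x + y| ^+ 2 = `|x| ^+ 2 + ('[x, y] + '[y, x]) + `|y| ^+ 2.
Proof. by rewrite !sqr_norm_inner linearDl !linearDr -!addrA. Qed.

Lemma parallelogram x y :
  `|x - y| ^+ 2 + `|x + y| ^+ 2 = 2 * (`|x| ^+ 2 + `|y| ^+ 2).
Proof.
rewrite !sqr_normD normrN linearNl linearNr.
by ring.
Qed.

(** The nonnegative number [`|u| ^+ 2], where [u] is [`|p| ^+ 2] times the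
component of [x] orthogonal to [p], is [`|p| ^+ 2] times the difference of the
squares of the two sides. *)
Lemma inner_cauchy_schwarz x p : `|'[x, p]| <= `|x| * `|p|.
Proof.
have [->|p0] := eqVneq p 0; first by rewrite linear0r !normr0 mulr0.
pose u := `|p| ^+ 2 *: x - '[x, p] *: p.
have up : '[u, p] = 0.
  rewrite innerBl !innerZl /= sqr_norm_inner.
  by rewrite mulrC subrr.
have uu : `|u| ^+ 2 = `|p| ^+ 2 * (`|p| ^+ 2 * `|x| ^+ 2 - `|'[x, p]| ^+ 2).
  rewrite sqr_norm_inner {2}/u innerBr innerZr_ge0 ?exprn_ge0//.
  have -> : '[u, '[x, p] *: p] = 0.
    rewrite innerC innerZl /= (innerC p u) up.
    by rewrite !(conj0 scalars, mulr0).
  rewrite subr0 /u innerBl !innerZl /= -sqr_norm_inner.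
  by rewrite (innerC p x) mulr_conj.
have p2 : 0 < `|p| ^+ 2 by rewrite exprn_gt0 ?normr_gt0.
have : 0 <= `|u| ^+ 2 by rewrite exprn_ge0.
rewrite uu pmulr_rge0 // subr_ge0 -exprMn ler_sqr ?nnegrE ?mulr_ge0//.
by rewrite mulrC.
Qed.

Lemma inner_continuous p : continuous (fun x => '[x, p] : F^o).
Proof.
move=> x; apply/(@cvgrPdist_lt _ F^o) => e e0.
have M0 : 0 < `|p| + 1 by rewrite ltr_wpDl.
apply/nbhs_ballP; exists (e / (`|p| + 1)); first by rewrite /= divr_gt0.
move=> y; rewrite -ball_normE /= => xy.
rewrite -innerBl (le_lt_trans (inner_cauchy_schwarz _ _))//.
rewrite (@le_lt_trans _ _ (`|x - y| * (`|p| + 1)))//.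
  by rewrite ler_wpM2l// lerDl.
by rewrite -ltr_pdivlMr.
Qed.

(** Let [d] be the supremum of the numbers [l] such that [l <= `|w| ^+ 2] near
[G]; it is finite because each set of [G] meets a fixed ball.  If [v] and [w]
lie in a convex set of [G] on which [d - e < `|.| ^+ 2], and if their squared
norms are less than [d + e], then the midpoint has squared norm more than
[d - e], and the parallelogram law gives [`|v - w| ^+ 2 < 8 e].  The filter
[Psi] generated by [G] and the balls of squared radius [d + e] is thus Cauchy;
it is proper because [d] is a supremum, and its limit is a cluster point of the
coarser filter [G].  The last clause makes the same lemma produce points of
least norm, for [G] the filter of the sets that contain a given convex set. *)
Lemma convex_filter_cluster (G : set_system H) (PG : ProperFilter G) (M : F) :
  (forall P, G P -> exists2 v, P v & `|v| ^+ 2 <= M) ->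
  (forall P, G P -> exists Q, [/\ Q `<=` P, G Q &
     forall v w, Q v -> Q w -> Q (2^-1 *: (v + w))]) ->
  exists2 v, cluster G v &
    forall e, 0 < e -> \forall w \near G, `|v| ^+ 2 <= `|w| ^+ 2 + e.
Proof.
move=> Gbnd Gcvx.
pose L := [set l : F | 0 <= l /\ G [set w | l <= `|w| ^+ 2]].
have L0 : L 0.
  split=> //; apply: filterS filterT => w _ /=; exact: exprn_ge0.
have [|d [Ld dL]] := exists_sup (M := M) scalars (ex_intro _ 0 L0).
  move=> l [l0 Gl]; rewrite l0 /=; have [v /= lv vM] := Gbnd _ Gl.
  exact: le_trans vM.
have d0 : 0 <= d by exact: Ld.
have low e : 0 < e -> G [set w | d - e < `|w| ^+ 2].
  by move=> /dL[l [_ Gl] dl]; apply: filterS Gl => w /=; exact: lt_le_trans.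
have high P e : G P -> 0 < e -> exists2 v, P v & `|v| ^+ 2 < d + e.
  move=> GP e0; apply: contrapT => noP.
  have : L (d + e).
    split; first by rewrite addr_ge0// ltW.
    apply: filterS GP => w Pw /=.
    rewrite real_leNgt ?realD ?ger0_real ?(ltW e0) ?exprn_ge0//.
    by apply/negP => wd; apply: noP; exists w.
  by move=> /Ld; rewrite gerDl => /le_gtF; rewrite e0.
pose Psi := filter_from [set q : set H * F | G q.1 /\ 0 < q.2]
  (fun q => q.1 `&` [set w | `|w| ^+ 2 < d + q.2]).
have FPsi : ProperFilter Psi.
  apply: filter_from_proper; last first.
    by move=> [P e] [/= GP e0]; have [v Pv ve] := high _ _ GP e0; exists v.
  apply: filter_from_filter; first by
    exists (setT, 1); split=> //; exact: filterT.
  move=> [P e] [Q e'] [/= GP e0] [/= GQ e'0].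
  wlog ee' : P Q e e' GP GQ e0 e'0 / e <= e'.
    move=> wlg; have := real_leVge (gtr0_real e0) (gtr0_real e'0).
    case/orP => [/wlg|/wlg]; first exact.
    by rewrite setIC; exact.
  exists (P `&` Q, e) => /=; first by split=> //; exact: filterI.
  move=> w /= [[Pw Qw] we]; split=> //; split=> //=.
  by rewrite (lt_le_trans we) // lerD2l.
have cPsi : cauchy Psi.
  apply: cauchy_exP => _/posnumP[e].
  (* The parallelogram law loses a factor 8. *)
  pose e' := e%:num ^+ 2 / 8.
  have e'0 : 0 < e' by rewrite divr_gt0.
  have [Q [Qlow GQ Qcvx]] := Gcvx _ (low _ e'0).
  have [v Qv vd] := high _ _ GQ e'0.
  exists v, (Q, e') => // w /= [Qw wd]; rewrite -ball_normE /=.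
  rewrite -ltr_sqr ?nnegrE//.
  have /= := Qlow _ (Qcvx _ _ Qv Qw); rewrite normrZ exprMn => vwd.
  have -> : `|v - w| ^+ 2 = 2 * (`|v| ^+ 2 + `|w| ^+ 2) - `|v + w| ^+ 2.
    by rewrite -parallelogram addrK.
  have -> : e%:num ^+ 2 = 2 * ((d + e') + (d + e')) - 4 * (d - e').
    by rewrite /e'; field.
  rewrite ltrD// ?ltrN2 ?ltr_pM2l ?ltrD//.
  rewrite (_ : `|v + w| ^+ 2 = 4 * (`|2^-1| ^+ 2 * `|v + w| ^+ 2)) ?ltr_pM2l//.
  by rewrite ger0_norm ?invr_ge0//; field.
have [v Psiv] : exists v : H, Psi --> v by exists (lim Psi); exact: cauchy_cvg.
have vd : `|v| ^+ 2 <= d.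
  apply/ler_addgt0Pr => e e0.
  have clo : closed [set w : H | - (d + e) <= - `|w| ^+ 2].
    apply: closed_ger => w; apply: cvgN.
    by under eq_fun do rewrite expr2; apply: cvgM; exact: norm_continuous.
  suff : - (d + e) <= - `|v| ^+ 2 by rewrite lerN2.
  apply: (clo v) => B /Psiv PsiB.
  apply: (@filter_ex _ Psi); apply: filterI PsiB.
  exists (setT, e); first by split => //; exact: filterT.
  by move=> w [_ /= /ltW]; rewrite lerN2.
exists v.
  move=> A B GA /Psiv [[P e] [/= GP e0] PB].
  have [w [Aw Pw] we] := high _ _ (filterI GA GP) e0.
  by exists w; split=> //; exact: PB.
move=> e e0; apply: filterS (low _ e0) => w /= dw.
by rewrite (le_trans vd) // -lerBlDr ltW.
Qed.

(** A named function can carry the structure of a linear map. *)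
Definition inner_left (p : H) : H -> F^o := fun x => '[x, p].

Lemma inner_left_linear p : linear (inner_left p).
Proof. by move=> a x y; rewrite /inner_left innerDl innerZl. Qed.

HB.instance Definition _ p :=
  GRing.isLinear.Build F H F^o *:%R (inner_left p) (inner_left_linear p).

Definition inner_dual p : dual H :=
  @Dual F H (inner_left p) (@inner_continuous p).

(** For [C] nonempty, take the inner product with its point [p] of least norm.
For [z] in [C] the segment from [p] to [z] stays in [C], so the derivative at [p] of the
squared norm along it is nonnegative: twice the real part of ['[z - p, p]] is
nonnegative, whence [`|p| ^+ 2 <= `|'[z, p]|]. *)
Lemma closed_convex_separation (C : set H) :
  closed C -> convex_set C -> ~ C 0 ->
  exists f : dual H, exists2 c, 0 < c & forall z, C z -> c <= `|f z|.
Proof.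
move=> clC /convex_setP cvxC C0.
have [[z0 Cz0]|Cempty] := pselect (C !=set0); last first.
  by exists (inner_dual 0), 1 => // z Cz; case: Cempty; exists z.
have PG := globally_properfilter Cz0.
have [||p clusterp pmin] := @convex_filter_cluster _ PG (`|z0| ^+ 2).
- by move=> P CP; exists z0 => //; exact: CP.
- move=> P CP; exists C; split=> // v w Cv Cw.
  rewrite scalerDr [X in _ + X *: _](_ : _ = 1 - 2^-1); last by field.
  by apply: cvxC => //; rewrite invr_ge0 ler0n invf_le1// ler1n.
have Cp : C p by apply: clC => B; exact: clusterp.
have {}pmin w : C w -> `|p| ^+ 2 <= `|w| ^+ 2.
  by move=> Cw; apply/ler_addgt0Pr => e e0; exact: pmin e0 w Cw.
exists (inner_dual p), (`|p| ^+ 2).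
  by rewrite exprn_gt0// normr_gt0; apply: contra_notN C0 => /eqP <-.
move=> z Cz; rewrite /= /inner_left.
(* Moving from p to p + t * (z - p) changes the squared norm by t * (s + t * n),
   where s is the sum below; the t chosen makes t * n at most e. *)
have var : 0 <= '[p, z - p] + '[z - p, p].
  apply/ler_addgt0Pr => e e0; set n := `|z - p| ^+ 2.
  have n0 : 0 <= n by rewrite exprn_ge0.
  have en0 : 0 < e + n by rewrite ltr_wpDr.
  pose t := e / (e + n).
  have t0 : 0 < t by rewrite divr_gt0.
  have t1 : t <= 1 by rewrite ler_pdivrMr// mul1r lerDl.
  have := pmin _ (cvxC t z p _ Cz Cp).
  rewrite (ltW t0) t1 => /(_ isT).
  have -> : t *: z + (1 - t) *: p = p + t *: (z - p).
    by rewrite scalerBl scale1r scalerBr addrCA.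
  rewrite sqr_normD innerZl innerZr_ge0 ?(ltW t0)// -mulrDr normrZ exprMn.
  rewrite (ger0_norm (ltW t0)) -/n -addrA lerDl expr2 -mulrA -mulrDr.
  rewrite pmulr_rge0// => /le_trans; apply; rewrite lerD2l.
  by rewrite /t mulrAC ler_pdivrMr// ler_wpM2l ?(ltW e0)// lerDr ltW.
have : `|p| ^+ 2 *+ 2 <= '[p, z] + '[z, p].
  move: var; rewrite innerBr innerBl -sqr_norm_inner.
  by rewrite addrACA -opprD subr_ge0.
have zz0 : 0 <= `|p| ^+ 2 *+ 2 by rewrite mulrn_wge0// exprn_ge0.
have nC : `|'[p, z]| = `|'[z, p]| by rewrite innerC norm_conj.
move=> le2; have := ler_normD '[p, z] '[z, p].
rewrite ger0_norm ?(le_trans zz0)// nC -mulr2n => /(le_trans le2).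
by rewrite lerMn2r.
Qed.

End HilbertSpace.

(** * Closed operators *)

Section Operators.
Variables (F : numFieldType) (conj : F -> F).
Hypothesis scalars : real_or_complex conj.
Variables (H K : hilbertType conj) (T : operator H K).

Lemma operator0 : T 0 = 0.
Proof.
have := @app_linear _ _ _ T 1 0 0 (@dom0 _ _ _ T) (@dom0 _ _ _ T).
rewrite scaler0 addr0 scale1r => /eqP.
by rewrite -subr_eq0 opprD addNKr oppr_eq0 => /eqP.
Qed.

Lemma dom_comb a b x y : dom T x -> dom T y -> dom T (a *: x + b *: y).
Proof.
move=> Tx Ty; apply: dom_linear => //; rewrite -[_ *: y]addr0.
exact: dom_linear (dom0 T).
Qed.

Lemma app_comb a b x y : dom T x -> dom T y ->
  T (a *: x + b *: y) = a *: T x + b *: T y.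
Proof.
move=> Tx Ty; have Tby : dom T (b *: y + 0) by exact: dom_linear (dom0 T).
rewrite -[X in _ + X]addr0 app_linear// app_linear//; last exact: dom0.
by rewrite operator0 addr0.
Qed.

Lemma domZ a x : dom T x -> dom T (a *: x).
Proof. by move=> Tx; have := dom_comb a 0 Tx Tx; rewrite scale0r addr0. Qed.

Lemma appZ a x : dom T x -> T (a *: x) = a *: T x.
Proof. by move=> Tx; have := app_comb a 0 Tx Tx; rewrite !scale0r !addr0. Qed.

Lemma convex_preimage (D : set K) : convex_set D ->
  convex_set [set x | dom T x /\ D (T x)].
Proof.
move=> /convex_setP cD; apply/convex_setP => t x y t01 [Tx Dx] [Ty Dy].
by split; [exact: dom_comb|rewrite app_comb//; exact: cD].
Qed.

(** For [x] in the closure of the set, the images of its intersections with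
small balls around [x] are convex, and are bounded since they lie in [D].  They
therefore cluster at some [v]; then [(x, v)] is in the closure of the graph,
and [v] is in that of [D]. *)
Lemma closed_preimage_bounded_convex (D : set K) (M : F) :
  closed_operator T -> closed D -> convex_set D ->
  (forall v, D v -> `|v| <= M) -> closed [set x | dom T x /\ D (T x)].
Proof.
move=> clT clD cD DM x clx; set C := [set x | _] in clx.
pose G : set_system K := T @ within C (nbhs x).
have PW : ProperFilter (within C (nbhs x)) by exact: within_nbhs_proper.
have PG : ProperFilter G by exact: fmap_proper_filter.
have /convex_setP cC := convex_preimage cD.
have GD : G D by apply: (@nearW _ (nbhs x)) => y [].
have [||v Gv _] := @convex_filter_cluster _ _ scalars K G PG (M ^+ 2).
- move=> P GP; have [v [Pv Dv]] := filter_ex (filterI GP GD).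
  exists v => //; have vM := DM v Dv.
  by rewrite lerXn2r ?nnegrE//; exact: le_trans vM.
- move=> P /nbhs_ballP[e /= e0 eP].
  exists (T @` (C `&` ball x e)); split.
  + by move=> _ [y [Cy xy] <-]; exact: eP.
  + apply/nbhs_ballP; exists e => //= y xy Cy; by exists y.
  + move=> _ _ [y [Cy xy] <-] [z [Cz xz] <-].
    have [Ty _] := Cy; have [Tz _] := Cz.
    exists (2^-1 *: y + 2^-1 *: z); last by rewrite app_comb// scalerDr.
    split.
      rewrite [X in _ + X *: _](_ : _ = 1 - 2^-1); last by field.
      by apply: cC => //; rewrite invr_ge0 ler0n invf_le1// ler1n.
    move: xy xz; rewrite -!ball_normE /= => xy xz.
    have -> : x - (2^-1 *: y + 2^-1 *: z) = 2^-1 *: ((x - y) + (x - z)).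
      rewrite addrACA -opprD scalerBr -mulr2n -[x *+ 2]scaler_nat scalerA.
      by rewrite mulVf// scale1r scalerDr.
    rewrite normrZ gtr0_norm ?invr_gt0// ltr_pdivrMl// mulr_natl mulr2n.
    by rewrite (le_lt_trans (ler_normD _ _))// ltrD.
have : graph T (x, v).
  apply: clT => B [[B1 B2] /= [xB1 vB2] sB].
  have [w [[y [Cy B1y] yw] B2w]] : (T @` (C `&` B1)) `&` B2 !=set0.
    apply: Gv => //; apply: filterS xB1 => y B1y Cy; by exists y.
  exists (y, w); split; first by split; [exact: Cy.1|].
  exact: sB.
move=> [/= Tx vE]; split=> //; rewrite -vE.
by apply: clD => B; exact: Gv.
Qed.

(** This is the weak continuity of [T] at [0] on the inverse image of the unit
ball, for a single [g].  The set of all [z] there with [e <= g (T z)] is closed,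
convex and does not contain [0], so it is separated from [0] by some [f].  Any
[z] with [e <= `|g (T z)|] is brought into this set by a scalar [u] of modulus
[1], which does not change [`|f z|]. *)
Lemma dual_small_on_ball (g : dual K) (e : F) : closed_operator T -> 0 < e ->
  exists f : dual H, exists2 c, 0 < c &
    forall z, dom T z -> `|T z| <= 1 -> `|f z| < c -> `|g (T z)| < e.
Proof.
move=> clT e0.
pose D := [set v : K | `|v| <= 1] `&` [set v : K | e <= g v].
have clD : closed D.
  apply: closedI; first exact: closed_norm_le.
  by apply: closed_ger; exact: dual_continuous.
have cD : convex_set D.
  apply/convex_setP => t v w t01 [v1 /= gv] [w1 /= gw].
  split; first by move/convex_setP: (@convex_norm_le _ K 1); exact.
  move: t01 => /andP[t0 t1]; rewrite /= linearD !linearZ /=.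
  have -> : e = t * e + (1 - t) * e by ring.
  by rewrite lerD// ler_wpM2l// subr_ge0.
have DM v : D v -> `|v| <= 1 by case.
have [|f [c c0 fc]] := closed_convex_separation scalars
  (closed_preimage_bounded_convex clT clD cD DM) (convex_preimage cD).
  by move=> [_ [_ /=]]; rewrite operator0 linear0 => /le_gtF; rewrite e0.
exists f, c => // z Tz z1 fz.
rewrite real_ltNge ?normr_real ?(gtr0_real e0)//; apply/negP => ge.
have g0 : g (T z) != 0 by rewrite -normr_gt0 (lt_le_trans e0).
pose u := `|g (T z)| / g (T z).
have u1 : `|u| = 1 by rewrite normrM normr_id normfV divff// normr_eq0.
have := fc (u *: z); rewrite linearZ /= normrM u1 mul1r => cf.
suff /cf/le_gtF : dom T (u *: z) /\ D (T (u *: z)) by rewrite fz.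
rewrite /= appZ//; split; first exact: domZ.
split=> /=; first by rewrite normrZ u1 mul1r.
by rewrite linearZ /= [_ *: _]divfK.
Qed.

End Operators.

Lemma closable_extension (F : numFieldType) (V W : normedModType F)
    (T : operator V W) : closable T ->
  exists T' : operator V W, closed_operator T' /\
    forall x, dom T x -> dom T' x /\ T x = T' x.
Proof.
move=> [T' clT']; exists T'; split.
  by rewrite /closed_operator -clT'; exact: closed_closure.
move=> x Tx; have : closure (graph T) (x, T x) by apply: subset_closure.
by rewrite clT'.
Qed.

(** * Weak topologies *)

Lemma weak_dual_continuous (F : numFieldType) (V : normedModType F)
    (f : dual V) :
  continuous (f : weak_topology V -> F^o).
Proof.
move=> x; apply: (@cvg_comp _ _ _ id f _ (nbhs (x : initial_topology f))).
  pose weak (h : dual V) := Topological.on (initial_topology h).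
  have := @cvg_sup V (dual V) weak (nbhs (x : weak_topology V)) x _.
  by case=> + _; apply; exact: cvg_id.
exact: initial_continuous.
Qed.

Lemma continuous_weak (F : numFieldType) (V : normedModType F)
    (X : topologicalType) (h : X -> weak_topology V) :
  (forall g : dual V, continuous (fun x => g (h x) : F^o)) -> continuous h.
Proof.
move=> ch x.
pose weak (f : dual V) := Topological.on (initial_topology f).
apply/(@cvg_sup V (dual V) weak) => g.
exact: (@continuous_comp_initial _ _ _ g h (ch g)).
Qed.

Theorem lemma4p3 (F : numFieldType) (conj : F -> F)
    (scalars : real_or_complex conj) (H K : hilbertType conj)
    (T : operator H K) (dense_dom : dense (dom T)) (closable_T : closable T) :
  let S : set H := [set x | dom T x /\ `|T x| <= 1] in
  ({within (S : set (weak_topology H)),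
      continuous (T : weak_topology H -> weak_topology K)} /\
   closed (S : set (subspace (dom T)))) /\
  (closed_operator T -> closed S).
Proof.
move=> S.
have closed_ball_preimage (T' : operator H K) : closed_operator T' ->
    closed [set x | dom T' x /\ `|T' x| <= 1].
  move=> clT'.
  apply: (closed_preimage_bounded_convex scalars clT' _ _ (fun _ => id)).
    exact: closed_norm_le.
  exact: convex_norm_le.
have [T' [closedT' ext]] := closable_extension closable_T.
split; last exact: closed_ball_preimage.
split; last first.
  apply/closed_subspaceP; exists [set x | dom T' x /\ `|T' x| <= 1].
    exact: closed_ball_preimage.
  apply/seteqP; split=> x /=.
    by move=> [[_ T'x] Tx]; rewrite /S /= (ext x Tx).2.
  move=> [[Tx x1] _]; have [T'x Tx'] := ext x Tx.
  by rewrite -Tx'; split.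
apply: continuous_weak => g x; rewrite /continuous_at /from_subspace.
case: (nbhs_subspaceP (S : set (weak_topology H)) x) => Sx; last first.
  (* Outside of S the points of the subspace topology are isolated. *)
  by move=> A /nbhs_singleton gA y ->.
have FW := within_filter (S : set (weak_topology H))
  (nbhs_filter (x : weak_topology H)).
apply/(@cvgrPdist_lt _ F^o _ _ FW) => e e0.
have e20 : 0 < e / 2 by rewrite divr_gt0.
have [f [c c0 fc]] := dual_small_on_ball scalars g closedT' e20.
have c20 : 0 < 2 * c by rewrite mulr_gt0.
have := @weak_dual_continuous _ _ f x => /(@cvgrPdist_lt _ F^o) /(_ _ c20).
apply: filterS => y fxy Sy.
have [Tx x1] := Sx; have [Ty y1] := Sy.
have [[T'x Tx'] [T'y Ty']] := (ext x Tx, ext y Ty).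
(* Half the difference of x and y is again mapped into the unit ball. *)
have half (V : normedModType F) (h : dual V) u v :
    `|h (2^-1 *: u + - 2^-1 *: v)| = 2^-1 * `|h u - h v|.
  by rewrite scaleNr -scalerBr linearZ linearB normrZ gtr0_norm ?invr_gt0.
have := fc _ (dom_comb 2^-1 (- 2^-1) T'x T'y).
rewrite app_comb// -Tx' -Ty' !half !ltr_pdivrMl// [2 * (e / 2)]mulrC divfK//.
apply=> //; rewrite scaleNr -scalerBr normrZ gtr0_norm ?invr_gt0//.
rewrite ler_pdivrMl// (le_trans (ler_normB _ _))//.
by rewrite mulr1 -[2]/(1 + 1) lerD.
Qed.
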